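(* Let $G$ be a finitely generated recursively presented group and $H\le G$ a finitely generated subgroup. If $H$ is realizable in $G$, then the subgroup membership problem of $H$ in $G$ is decidable.
   Context: A finitely generated group $G$ is recursively presented if it has a presentation $\langle S\mid R\rangle$ with $S$ recursive and $R$ recursively enumerable. Fix a finite symmetric generating set $S$ of $G$; for a word $w\in S^*$ let $\overline w\in G$ be the element it represents. The subgroup membership problem of $H$ in $G$ is the decision problem: given words $u,w_1,\dots,w_k\in S^*$ such that $H=\langle \overline w_1,\dots,\overline w_k\rangle$, determine whether $\overline u\in H$. Let $A$ be a non-empty finite set. $G$ acts on $A^G$ by $(g\cdot x)(h)=x(g^{-1}h)$. A pattern is a map $p:F\to A$ with $F\subset G$ finite; it appears in $x\in A^G$ if there is $g\in G$ with $p(h)=x(gh)$ for all $h\in F$. A subset $X\subseteq A^G$ is a subshift of finite type ($G$-SFT) if it consists of exactly those configurations in which no pattern of some finite set $\mathcal F$ of patterns appears. For $x\in A^G$, $\mathrm{stab}(x)=\{g\in G: g\cdot x=x\}$, and $\mathrm{stab}(X)=\{\mathrm{stab}(x): x\in X\}$. A subgroup $H\le G$ is realizable in $G$ if there exist a finite alphabet $A$ and a non-empty $G$-SFT $X\subseteq A^G$ with $\mathrm{stab}(X)=\{H\}$. *)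

(* Defs.v *)
From HB Require Import structures.
From mathcomp Require Import all_boot finmap.
From mathcomp Require Import boolp classical_sets.

Set Implicit Arguments.
Unset Strict Implicit.
Unset Printing Implicit Defensive.

Local Open Scope classical_set_scope.
Local Open Scope group_scope.

(* Kleene's general recursive functions.  Minimisation is restricted to the
   regular case (a zero always exists), so the class consists exactly of the
   total computable functions of several natural-number arguments.            *)
Inductive recursive_fun : forall n : nat, (n.-tuple nat -> nat) -> Prop :=
| RecZero n : recursive_fun (fun _ : n.-tuple nat => 0)
| RecSucc : recursive_fun (fun v : 1.-tuple nat => (thead v).+1)
| RecProj n (i : 'I_n) : recursive_fun (fun v : n.-tuple nat => tnth v i)
| RecComp n m (f : m.-tuple nat -> nat) (g : 'I_m -> n.-tuple nat -> nat) :
    recursive_fun f -> (forall i, recursive_fun (g i)) ->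
    recursive_fun (fun v => f [tuple g i v | i < m])
| RecPrim n (f : n.-tuple nat -> nat) (g : n.+2.-tuple nat -> nat) :
    recursive_fun f -> recursive_fun g ->
    recursive_fun (fun v : n.+1.-tuple nat =>
      nat_rect (fun=> nat) (f [tuple of behead v])
        (fun k r => g [tuple of k :: r :: behead v]) (thead v))
| RecMu n (f : n.+1.-tuple nat -> nat) (g : n.-tuple nat -> nat) :
    recursive_fun f ->
    (forall v, f [tuple of g v :: v] = 0
      /\ forall k, (k < g v)%N -> f [tuple of k :: v] <> 0) ->
    recursive_fun g.

Definition recursive_set (K : set nat) : Prop :=
  recursive_fun (fun v : 1.-tuple nat => nat_of_bool `[< K (thead v) >]).

Definition re_set (K : set nat) : Prop :=
  K = set0 \/
  exists2 f : 1.-tuple nat -> nat,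
    recursive_fun f & K = range (fun k => f [tuple k]).

(* Words over S^{+-1} for an alphabet S of natural numbers: the letter (a, b)
   stands for a if b = false and for a^-1 if b = true.                        *)
Definition gword : Type := seq (nat * bool).

Definition word_over (S : set nat) (w : gword) : Prop :=
  forall l, l \in w -> S l.1.

Definition gword_code (w : gword) : nat :=
  CodeSeq.code [seq (nat_of_bool l.2 + l.1.*2)%N | l <- w].

(* Equality in <S | R>: the congruence on words over S^{+-1} generated by free
   cancellation and by r = 1 for r in R.                                      *)
Inductive pres_eq (S : set nat) (R : set gword) : gword -> gword -> Prop :=
| PresRefl u : pres_eq S R u u
| PresSym u v : pres_eq S R u v -> pres_eq S R v u
| PresTrans u v w : pres_eq S R u v -> pres_eq S R v w -> pres_eq S R u w
| PresCancel u v a b : S a ->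
    pres_eq S R (u ++ (a, b) :: (a, ~~ b) :: v) (u ++ v)
| PresRel u v r : R r -> pres_eq S R (u ++ r ++ v) (u ++ v).

Section Group.
Variable G : groupType.
Implicit Types (H : set G) (S : {fset G}).

Definition geval (phi : nat -> G) (w : gword) : G :=
  \prod_(l <- w) (if l.2 then (phi l.1)^-1 else phi l.1).

(* Sending each a in S to phi a induces an isomorphism from <S | R> onto G;
   the values of phi outside S are irrelevant.                                *)
Definition presents (S : set nat) (R : set gword) (phi : nat -> G) : Prop :=
  (forall g, exists2 w, word_over S w & geval phi w = g) /\
  (forall u v, word_over S u -> word_over S v ->
     geval phi u = geval phi v <-> pres_eq S R u v).

Definition recursively_presented : Prop :=
  exists (S : set nat) (R : set gword) (phi : nat -> G),
    [/\ recursive_set S, re_set (gword_code @` R), R `<=` word_over S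
      & presents S R phi].

Definition subgroup H : Prop :=
  [/\ H 1, (forall x y, H x -> H y -> H (x * y))
    & (forall x, H x -> H x^-1)].

Definition generated (B : set G) : set G := smallest subgroup B.

Definition finitely_generated H : Prop :=
  exists S, H = generated [set` S].

Definition symmetric_generating S : Prop :=
  (forall x, x \in S -> x^-1 \in S) /\ generated [set` S] = [set: G].

Definition weval S (w : seq S) : G := \prod_(s <- w) val s.

Definition word_code S (w : seq S) : nat :=
  CodeSeq.code [seq nat_of_ord (enum_rank s) | s <- w].

(* The input (u, w_1, ..., w_k) is coded by one number; as this is a promise
   problem, the answer is prescribed only when the w_i generate H.            *)
Definition membership_decidable S H : Prop :=
  exists2 f : 1.-tuple nat -> nat, recursive_fun f &
    forall (u : seq S) (ws : seq (seq S)),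
      H = generated [set` [seq weval w | w <- ws]] ->
      f [tuple CodeSeq.code [seq word_code w | w <- u :: ws]]
        = nat_of_bool `[< H (weval u) >].

Section Shift.
Variable A : finType.
Implicit Types (x : G -> A) (X : set (G -> A)).

Definition shift (g : G) x : G -> A := fun h => x (g^-1 * h).

Definition appears (p : {fmap G -> A}) x : Prop :=
  exists g : G, forall h : domf p, p h = x (g * val h).

Definition is_SFT X : Prop :=
  exists F : {fset {fmap G -> A}},
    X = [set x | forall p, p \in F -> ~ appears p x].

Definition stab x : set G := [set g | shift g x = x].

End Shift.

Definition realizable H : Prop :=
  exists (A : finType) (X : set (G -> A)),
    [/\ (0 < #|A|)%N, X !=set0, is_SFT X & @stab A @` X = [set H]].

End Group.

(* Main.v *)
Require Import Defs.
From HB Require Import structures.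
From mathcomp Require Import all_boot finmap.
From mathcomp Require Import zify.
From mathcomp Require Import boolp classical_sets.

(** Membership in H and non-membership in H are both semi-decidable, and a
    parallel search (Post's theorem, [recursive_complement]) decides. Since H is
    fixed, the generators given with the input can be ignored, and the finite data
    attached to H and to a subshift X realising it can be built into the
    algorithm.

    Stabilisers of translates are conjugate, so H, being the only stabiliser in X,
    is normal ([stab_normal]). Adding words for finitely many generators of H to
    the relators of G thus presents G / H, and a word u represents an element of H
    if and only if it can be derived from the empty word by inserting and deleting
    relators ([membership_connected]). The relators being recursively enumerable,
    this is a search for a derivation.

    For the complement, let a word u be given, and consider the colourings of all
    words that are constant on classes modulo the relators, invariant under left
    multiplication by u, and free of the forbidden patterns of X. These are the
    configurations of X fixed by u, so such a colouring exists if and only if u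
    represents an element of H ([tilingP]). The conditions are a recursive
    sequence of constraints, each on finitely many words; by compactness, in the
    form of Koenig's lemma, they are contradictory if and only if finitely many of
    them already exclude all colourings of a finite set of words
    ([satisfiableP]), which is again a search.

    Words are identified with numbers. In binary, the concatenation of sequences
    corresponds to the concatenation of codes ([code_cat]), which keeps the
    verification that the searches are recursive elementary. *)

Set Implicit Arguments.
Unset Strict Implicit.
Unset Printing Implicit Defensive.

Local Open Scope classical_set_scope.

(** * Closure properties of recursive functions *)

(** Functions of a list rather than of a tuple: a list plays the role of an
    environment of numerical variables, so that closure properties can be stated
    for open expressions, and binders push one more variable on its front. *)
Definition recursive n (f : seq nat -> nat) : Prop :=
  recursive_fun (fun v : n.-tuple nat => f v).

Lemma eq_recursive n (f g : seq nat -> nat) :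
  (forall v, size v = n -> f v = g v) -> recursive n f -> recursive n g.
Proof.
move=> fg; congr recursive_fun.
by apply: funext => v; rewrite fg ?size_tuple.
Qed.

Lemma recursive_comp n (F : seq nat -> nat) (gs : seq (seq nat -> nat)) :
  recursive (size gs) F ->
  (forall i, i < size gs -> recursive n (nth (fun=> 0) gs i)) ->
  recursive n (fun v => F [seq g v | g <- gs]).
Proof.
move=> rF rgs.
have := RecComp rF (fun i : 'I_(size gs) => rgs i (ltn_ord i)).
congr recursive_fun; apply: funext => v; congr F.
apply: (@eq_from_nth _ 0); first by rewrite size_tuple size_map.
move=> i; rewrite size_tuple => lti.
by rewrite (nth_map (fun=> 0)) // -(tnth_nth 0 _ (Ordinal lti)) tnth_mktuple.
Qed.

Lemma recursive_comp1 n (F : 1.-tuple nat -> nat) (g : seq nat -> nat) :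
  recursive_fun F -> recursive n g -> recursive n (fun v => F [tuple g v]).
Proof.
move=> rF rg; have := RecComp rF (fun _ : 'I_1 => rg).
congr recursive_fun; apply: funext => v; congr F.
by apply: eq_from_tnth => i; rewrite tnth_mktuple !ord1.
Qed.

Lemma recursive_proj n i : recursive n (fun v => nth 0 v i).
Proof.
have [lt_in|le_ni] := ltnP i n.
  have := RecProj (Ordinal lt_in); congr recursive_fun.
  by apply: funext => v; rewrite (tnth_nth 0).
apply: (@eq_recursive n (fun=> 0)); last exact: RecZero.
by move=> v sv; rewrite nth_default // sv.
Qed.

Lemma recursive_succ n f : recursive n f -> recursive n (fun v => (f v).+1).
Proof. by move=> rf; apply: (recursive_comp1 RecSucc rf). Qed.

Lemma recursive_const n c : recursive n (fun=> c).
Proof. by elim: c => [|c IHc]; [exact: RecZero | exact: recursive_succ]. Qed.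

(** Substitution in an expression F whose first variable is bound: F is read in
    an environment with j more variables in front than the one in which it was
    written, whence the suffix e. *)
Lemma recursive_subst j n (F : nat -> seq nat -> nat) a e :
  recursive n.+1 (fun v => F (nth 0 v 0) (behead v)) ->
  recursive (j + n) a -> (forall v, e v = drop j v) ->
  recursive (j + n) (fun v => F (a v) (e v)).
Proof.
move=> rF ra e_drop.
pose gs := a :: [seq (fun v => nth 0 v i) | i <- iota j n].
have sz_gs : size gs = n.+1 by rewrite /= size_map size_iota.
pose F' v := F (nth 0 v 0) (behead v).
apply: (@eq_recursive _ (fun v => F' [seq g v | g <- gs])).
  move=> v sv; rewrite /F' /gs e_drop /= -map_comp; congr F.
  apply: (@eq_from_nth _ 0).
    by rewrite size_map size_iota size_drop sv addKn.
  move=> i; rewrite size_map size_iota => lt_in.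
  by rewrite (nth_map 0) ?size_iota //= nth_iota // nth_drop.
apply: recursive_comp => [|i]; first by rewrite sz_gs.
rewrite sz_gs; case: i => [|i] //=; rewrite ltnS => lt_in.
rewrite (nth_map 0) ?size_iota // nth_iota //.
exact: recursive_proj.
Qed.

Lemma recursive_prim n (a m : seq nat -> nat)
    (step : nat -> nat -> seq nat -> nat) :
  recursive n a -> recursive n m ->
  recursive n.+2
    (fun v => step (nth 0 v 0) (nth 0 v 1) (behead (behead v))) ->
  recursive n
    (fun v => nat_rect (fun=> nat) (a v) (fun k r => step k r v) (m v)).
Proof.
move=> ra rm rstep.
pose P k v := nat_rect (fun=> nat) (a v) (fun k r => step k r v) k.
apply: (@recursive_subst 0 n P m id) => // [|v]; last by rewrite drop0.
have := RecPrim ra rstep; congr recursive_fun.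
by apply: funext => v; rewrite (tuple_eta v).
Qed.

Lemma recursive_mu n (P : nat -> seq nat -> bool) (g : seq nat -> nat) :
  recursive n.+1 (fun v => ~~ P (nth 0 v 0) (behead v)) ->
  (forall v, size v = n -> P (g v) v) -> (forall v k, P k v -> g v <= k) ->
  recursive n g.
Proof.
move=> rP Pg g_min; apply: (RecMu rP) => v; split=> [|k lt_kg] /=.
  by rewrite Pg ?size_tuple.
by case Pk: (P k v) => //; move: lt_kg; rewrite ltnNge g_min.
Qed.

(** Under binders the outer variables appear as entries of an iterated behead
    of the environment. Recording that such a list is some drop of the environment
    lets proof search recognise every variable at any binding depth. *)
Definition is_suffix (e : seq nat -> seq nat) := exists m, e = drop m.

Lemma is_suffix_id : is_suffix (fun v => v).
Proof. by exists 0; apply: funext => v; rewrite drop0. Qed.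

Lemma is_suffix_behead e : is_suffix e -> is_suffix (fun v => behead (e v)).
Proof.
by case=> m ->; exists m.+1; apply: funext => v; rewrite -drop1 drop_drop.
Qed.

Lemma recursive_var n e i : is_suffix e -> recursive n (fun v => nth 0 (e v) i).
Proof.
case=> m ->; apply: (@eq_recursive n (fun v => nth 0 v (m + i))).
  by move=> v _; rewrite nth_drop.
exact: recursive_proj.
Qed.

Lemma recursive_lift1 n (F : nat -> nat) f :
  recursive 1 (fun v => F (nth 0 v 0)) ->
  recursive n f -> recursive n (fun v => F (f v)).
Proof.
move=> rF rf; apply: (@recursive_comp n (fun v => F (nth 0 v 0)) [:: f] rF).
by case.
Qed.

(** Once an operation of two numbers is recursive in its own two variables, it
    may be applied to arbitrary recursive expressions. This reduces the
    closure lemmas below for arithmetic operations to plain recursions. *)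
Lemma recursive_lift2 n (F : nat -> nat -> nat) f g :
  recursive 2 (fun v => F (nth 0 v 0) (nth 0 v 1)) ->
  recursive n f -> recursive n g -> recursive n (fun v => F (f v) (g v)).
Proof.
move=> rF rf rg.
apply: (@recursive_comp n (fun v => F (nth 0 v 0) (nth 0 v 1)) [:: f; g] rF).
by case=> [|[]].
Qed.

Create HintDb recursive.
#[local] Hint Resolve recursive_const recursive_succ recursive_var : recursive.
#[local] Hint Resolve is_suffix_id is_suffix_behead : recursive.

Lemma recursive_add n f g :
  recursive n f -> recursive n g -> recursive n (fun v => f v + g v).
Proof.
apply: recursive_lift2.
apply: (@eq_recursive _ (fun v =>
  nat_rect (fun=> nat) (nth 0 v 1) (fun _ r => r.+1) (nth 0 v 0))).
  by move=> v _; elim: (nth 0 v 0) => //= k ->.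
by apply: recursive_prim; auto 20 with recursive.
Qed.
#[local] Hint Resolve recursive_add : recursive.

Lemma recursive_mul n f g :
  recursive n f -> recursive n g -> recursive n (fun v => f v * g v).
Proof.
apply: recursive_lift2.
apply: (@eq_recursive _ (fun v =>
  nat_rect (fun=> nat) 0 (fun _ r => nth 0 v 1 + r) (nth 0 v 0))).
  by move=> v _; elim: (nth 0 v 0) => //= k ->.
by apply: recursive_prim; auto 20 with recursive.
Qed.
#[local] Hint Resolve recursive_mul : recursive.

Lemma recursive_exp n f g :
  recursive n f -> recursive n g -> recursive n (fun v => f v ^ g v).
Proof.
apply: recursive_lift2.
apply: (@eq_recursive _ (fun v =>
  nat_rect (fun=> nat) 1 (fun _ r => nth 0 v 0 * r) (nth 0 v 1))).
  by move=> v _; elim: (nth 0 v 1) => //= k ->; rewrite expnS.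
by apply: recursive_prim; auto 20 with recursive.
Qed.
#[local] Hint Resolve recursive_exp : recursive.

Lemma recursive_pred n f : recursive n f -> recursive n (fun v => (f v).-1).
Proof.
apply: (@recursive_lift1 _ predn).
apply: (@eq_recursive _ (fun v =>
  nat_rect (fun=> nat) 0 (fun k _ => k) (nth 0 v 0))).
  by move=> v _; case: (nth 0 v 0).
by apply: recursive_prim; auto 20 with recursive.
Qed.
#[local] Hint Resolve recursive_pred : recursive.

Lemma recursive_sub n f g :
  recursive n f -> recursive n g -> recursive n (fun v => f v - g v).
Proof.
apply: recursive_lift2.
apply: (@eq_recursive _ (fun v =>
  nat_rect (fun=> nat) (nth 0 v 0) (fun _ r => r.-1) (nth 0 v 1))).
  move=> v _; elim: (nth 0 v 1) => [|k /= ->]; first by rewrite subn0.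
  by rewrite subnS.
by apply: recursive_prim; auto 20 with recursive.
Qed.
#[local] Hint Resolve recursive_sub : recursive.

Lemma recursive_neg n (b : seq nat -> bool) :
  recursive n b -> recursive n (fun v => ~~ b v).
Proof.
move=> rb; apply: (@eq_recursive _ (fun v => 1 - b v)) => [v _|].
  by case: (b v).
by auto 20 with recursive.
Qed.
#[local] Hint Resolve recursive_neg : recursive.

Lemma recursive_and n (b c : seq nat -> bool) :
  recursive n b -> recursive n c -> recursive n (fun v => b v && c v).
Proof.
move=> rb rc; apply: (@eq_recursive _ (fun v => b v * c v)) => [v _|].
  by case: (b v); case: (c v).
by auto 20 with recursive.
Qed.
#[local] Hint Resolve recursive_and : recursive.

Lemma recursive_or n (b c : seq nat -> bool) :
  recursive n b -> recursive n c -> recursive n (fun v => b v || c v).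
Proof.
move=> rb rc; apply: (@eq_recursive _ (fun v => ~~ (~~ b v && ~~ c v))).
  by move=> v _; case: (b v); case: (c v).
by auto 20 with recursive.
Qed.
#[local] Hint Resolve recursive_or : recursive.

Lemma recursive_leq n f g :
  recursive n f -> recursive n g -> recursive n (fun v => f v <= g v).
Proof.
move=> rf rg; apply: (@eq_recursive _ (fun v => 1 - (f v - g v))) => [v _|].
  by rewrite /leq; case: (f v - g v).
by auto 20 with recursive.
Qed.
#[local] Hint Resolve recursive_leq : recursive.

Lemma recursive_eq n f g :
  recursive n f -> recursive n g -> recursive n (fun v => f v == g v).
Proof.
move=> rf rg; apply: (@eq_recursive _ (fun v => (f v <= g v) && (g v <= f v))).
  by move=> v _; rewrite eqn_leq.
by auto 20 with recursive.
Qed.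
#[local] Hint Resolve recursive_eq : recursive.

Lemma recursive_if n (b : seq nat -> bool) f g :
  recursive n b -> recursive n f -> recursive n g ->
  recursive n (fun v => if b v then f v else g v).
Proof.
move=> rb rf rg.
apply: (@eq_recursive _ (fun v => b v * f v + ~~ b v * g v)) => [v _|].
  by case: (b v); rewrite ?mul1n ?addn0.
by auto 20 with recursive.
Qed.
#[local] Hint Resolve recursive_if : recursive.

(** Bounded quantification stays recursive: it is an iterated product. *)
Lemma recursive_all n (P : nat -> seq nat -> bool) t :
  recursive n t -> recursive n.+1 (fun v => P (nth 0 v 0) (behead v)) ->
  recursive n (fun v => all (fun k => P k v) (iota 0 (t v))).
Proof.
move=> rt rP; apply: (@eq_recursive _ (fun v =>
    nat_rect (fun=> nat) true (fun k r => r * P k v) (t v))).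
  move=> v _; elim: (t v) => // k IHk.
  by rewrite -[in RHS]addn1 iotaD all_cat /= andbT IHk mulnb.
apply: recursive_prim => //; auto 20 with recursive.
apply: recursive_mul; auto 20 with recursive.
apply: (@recursive_subst 2 n (fun k v => P k v) (nth 0 ^~ 0)
          (fun v => behead (behead v)) rP).
  exact: recursive_proj.
by move=> v; rewrite -drop1 -drop1 drop_drop.
Qed.
#[local] Hint Resolve recursive_all : recursive.

Lemma recursive_has n (P : nat -> seq nat -> bool) t :
  recursive n t -> recursive n.+1 (fun v => P (nth 0 v 0) (behead v)) ->
  recursive n (fun v => has (fun k => P k v) (iota 0 (t v))).
Proof.
move=> rt rP.
apply: (@eq_recursive _ (fun v => ~~ all (fun k => ~~ P k v) (iota 0 (t v)))).
  by move=> v _; rewrite -has_predC; congr nat_of_bool; apply: eq_has => k /=;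
     rewrite negbK.
by auto 20 with recursive.
Qed.
#[local] Hint Resolve recursive_has : recursive.

Lemma recursive_all_seq n (T : Type) (P : T -> seq nat -> bool) s :
  (forall x, recursive n (P x)) -> recursive n (fun v => all (P ^~ v) s).
Proof. by move=> rP; elim: s => [|x s IHs] /=; auto 20 with recursive. Qed.

Lemma recursive_has_seq n (T : Type) (P : T -> seq nat -> bool) s :
  (forall x, recursive n (P x)) -> recursive n (fun v => has (P ^~ v) s).
Proof. by move=> rP; elim: s => [|x s IHs] /=; auto 20 with recursive. Qed.

Lemma recursive_sumn n (T : Type) (f : T -> seq nat -> nat) s :
  (forall x, recursive n (f x)) ->
  recursive n (fun v => sumn [seq f x v | x <- s]).
Proof. by move=> rf; elim: s => [|x s IHs] /=; auto 20 with recursive. Qed.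
#[local] Hint Resolve recursive_all_seq recursive_has_seq : recursive.
#[local] Hint Resolve recursive_sumn : recursive.

Lemma recursive_div n f g :
  recursive n f -> recursive n g -> recursive n (fun v => f v %/ g v).
Proof.
apply: recursive_lift2.
apply: (@recursive_mu _ (fun q v =>
  (nth 0 v 1 == 0) || (nth 0 v 0 < q.+1 * nth 0 v 1))).
- by auto 20 with recursive.
- by move=> v _; case: posnP => //= d0; rewrite ltn_ceil.
move=> v q; case: posnP => [-> //|d0] /=.
by rewrite -ltn_divLR.
Qed.
#[local] Hint Resolve recursive_div : recursive.

Lemma recursive_mod n f g :
  recursive n f -> recursive n g -> recursive n (fun v => f v %% g v).
Proof.
move=> rf rg; apply: (@eq_recursive _ (fun v => f v - f v %/ g v * g v)).
  by move=> v _; rewrite [X in X - _](divn_eq (f v) (g v)) addKn.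
by auto 20 with recursive.
Qed.
#[local] Hint Resolve recursive_mod : recursive.

Lemma recursive_iter n F f k :
  recursive 1 (fun v => F (nth 0 v 0)) -> recursive n f -> recursive n k ->
  recursive n (fun v => iter (k v) F (f v)).
Proof.
move=> rF rf rk; apply: (@eq_recursive _ (fun v =>
    nat_rect (fun=> nat) (f v) (fun _ r => F r) (k v))) => //.
apply: recursive_prim => //.
by apply: (recursive_lift1 rF); auto 20 with recursive.
Qed.

(** * Recursive operations on coded sequences *)

Local Notation code := CodeSeq.code.
Local Notation decode := CodeSeq.decode.

Lemma recursive_logn n p f : prime p ->
  recursive n f -> recursive n (fun v => logn p (f v)).
Proof.
move=> p_pr; apply: (@recursive_lift1 _ (logn p)).
apply: (@recursive_mu _ (fun i v =>
  (nth 0 v 0 == 0) || (nth 0 v 0 %% p ^ i.+1 != 0))).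
- by auto 20 with recursive.
- move=> v _; case: posnP => //= c0.
  by rewrite [_ %% _ == 0]pfactor_dvdn // ltnn.
move=> v i; case: posnP => [->|c0] /=; first by rewrite logn0.
by rewrite [_ %% _ == 0]pfactor_dvdn // -leqNgt.
Qed.

(** In binary, lowest bit first, [code (n :: s)] consists of n zeros, a one, and
    then [code s]: the head is the 2-adic valuation, and the tail is obtained by
    a shift. *)
Definition tail_code c := c %/ 2 ^ (logn 2 c) %/ 2.

Lemma logn_code n s : logn 2 (code (n :: s)) = n.
Proof.
rewrite /= lognM ?expn_gt0 // pfactorK // lognE /= dvdn2 /= odd_double.
by rewrite addn0.
Qed.

Lemma code_behead s : code (behead s) = tail_code (code s).
Proof.
case: s => [|n s] //; rewrite /tail_code logn_code /= mulKn ?expn_gt0 //.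
by rewrite divn2 -[_.+1]/(true + _) half_bit_double.
Qed.

Lemma code_drop i s : code (drop i s) = iter i tail_code (code s).
Proof.
elim: i => [|i IHi]; first by rewrite drop0.
by rewrite -addn1 addnC -drop_drop drop1 code_behead IHi.
Qed.

Lemma recursive_drop n f i : recursive n f -> recursive n i ->
  recursive n (fun v => code (drop (i v) (decode (f v)))).
Proof.
move=> rf ri; apply: (@eq_recursive _ (fun v => iter (i v) tail_code (f v))).
  by move=> v _; rewrite code_drop CodeSeq.decodeK.
apply: recursive_iter => //; rewrite /tail_code.
have := @recursive_logn 1 2; auto 20 with recursive.
Qed.
#[local] Hint Resolve recursive_drop : recursive.

Lemma recursive_nth n f i : recursive n f -> recursive n i ->
  recursive n (fun v => nth 0 (decode (f v)) (i v)).
Proof.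
move=> rf ri; apply: (@eq_recursive _ (fun v =>
    logn 2 (code (drop (i v) (decode (f v)))))) => [v _|].
  rewrite -[i v in RHS]addn0 -nth_drop.
  by case: (drop _ _) => [|m s]; rewrite ?logn_code.
by apply: recursive_logn => //; auto 20 with recursive.
Qed.
#[local] Hint Resolve recursive_nth : recursive.

Lemma recursive_size n f :
  recursive n f -> recursive n (fun v => size (decode (f v))).
Proof.
apply: (@recursive_lift1 _ (fun c => size (decode c))).
have drop_eq0 i s : (code (drop i s) == 0) = (size s <= i).
  rewrite -subn_eq0 -size_drop; case: (drop i s) => //= m s'.
  by rewrite muln_eq0 expn_eq0.
apply: (@recursive_mu _ (fun i v => code (drop i (decode (nth 0 v 0))) == 0)).
- by auto 20 with recursive.
- by move=> v _; rewrite drop_eq0.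
by move=> v i; rewrite drop_eq0.
Qed.
#[local] Hint Resolve recursive_size : recursive.

Lemma recursive_foldl n (step : nat -> nat -> nat) a f :
  recursive 2 (fun v => step (nth 0 v 0) (nth 0 v 1)) ->
  recursive n a -> recursive n f ->
  recursive n (fun v => foldl step (a v) (decode (f v))).
Proof.
move=> rstep; apply: (@recursive_lift2 _ (fun x c => foldl step x (decode c))).
apply: (@eq_recursive _ (fun v => nat_rect (fun=> nat) (nth 0 v 0)
  (fun i r => step r (nth 0 (decode (nth 0 v 1)) i))
  (size (decode (nth 0 v 1))))).
  move=> v _; set s := decode _; set x := nth 0 v 0.
  suff foldl_take m : m <= size s ->
      nat_rect (fun=> nat) x (fun i r => step r (nth 0 s i)) m
        = foldl step x (take m s).
    by rewrite foldl_take // take_size.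
  elim: m => [|m IHm] lt_ms; first by rewrite take0.
  by rewrite (take_nth 0 lt_ms) foldl_rcons -IHm // ltnW.
apply: recursive_prim; auto 20 with recursive.
apply: (recursive_lift2 rstep); auto 20 with recursive.
Qed.

Definition bit_length x := up_log 2 x.+1.

Lemma recursive_bit_length n f :
  recursive n f -> recursive n (fun v => bit_length (f v)).
Proof.
apply: (@recursive_lift1 _ bit_length).
apply: (@recursive_mu _ (fun l v => nth 0 v 0 < 2 ^ l)).
- by auto 20 with recursive.
- by move=> v _; apply: up_logP.
by move=> v l; apply: up_log_min.
Qed.

(** By the binary description of codes, concatenating sequences concatenates
    their binary expansions; this makes concatenation recursive at once. *)
Lemma code_cat s t : code (s ++ t) = code s + 2 ^ bit_length (code s) * code t.
Proof.
elim: s => [|n s IHs] /=; first by rewrite /bit_length up_log1 mul1n.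
rewrite IHs; set c := code s; set d := code t.
suff -> : bit_length (2 ^ n * c.*2.+1) = n + (bit_length c).+1.
  by rewrite expnD expnS; nia.
rewrite /bit_length; elim: n => [|n IHn].
  by rewrite mul1n -doubleS up_log2_double.
rewrite expnS -mulnA mul2n up_log2S ?doubleK ?IHn //.
by rewrite double_gt0 muln_gt0 expn_gt0.
Qed.

Definition cat_code c d := code (decode c ++ decode d).

Lemma recursive_cat n f g : recursive n f -> recursive n g ->
  recursive n (fun v => cat_code (f v) (g v)).
Proof.
move=> rf rg.
apply: (@eq_recursive _ (fun v => f v + 2 ^ bit_length (f v) * g v)).
  by move=> v _; rewrite /cat_code code_cat !CodeSeq.decodeK.
by have := recursive_bit_length rf; auto 20 with recursive.
Qed.
#[local] Hint Resolve recursive_cat : recursive.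

(** * Decidability from two searches *)

(** Post's theorem: two complementary semi-decidable predicates are decidable,
    by searching for a witness of either one. *)
Lemma recursive_complement n (P Q : nat -> seq nat -> bool) :
  recursive n.+1 (fun v => P (nth 0 v 0) (behead v)) ->
  recursive n.+1 (fun v => Q (nth 0 v 0) (behead v)) ->
  (forall v, exists k, P k v || Q k v) ->
  (forall v k l, P k v -> ~~ Q l v) ->
  exists2 b : seq nat -> bool, recursive n b &
    forall v, b v <-> exists k, P k v.
Proof.
move=> rP rQ PQ disjPQ; pose g v := ex_minn (PQ v).
have rg : recursive n g.
  apply: (recursive_mu (P := fun k v => P k v || Q k v)).
  - by auto with recursive.
  - by move=> v _; rewrite /g; case: ex_minnP.
  by move=> v k Pk; rewrite /g; case: ex_minnP => m _; apply.
exists (fun v => P (g v) v) => [|v].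
  by apply: (@recursive_subst 0 n (fun k v => P k v) g id) => // v;
     rewrite drop0.
split=> [Pg|[k Pk]]; first by exists (g v).
rewrite /g; case: ex_minnP => m /orP[//|Qm] _.
by have := disjPQ v k m Pk; rewrite Qm.
Qed.

(** * Compactness of the space of colourings *)

(** A colouring of the first N numbers by k colours is a number below
    [k ^ N], the colours being its digits in base k. *)
Definition digit k c i := c %/ k ^ i %% k.

Lemma recursive_digit k n f i : recursive n f -> recursive n i ->
  recursive n (fun v => digit k (f v) (i v)).
Proof. by rewrite /digit => rf ri; auto with recursive. Qed.
#[local] Hint Resolve recursive_digit : recursive.

Lemma digits_surj k N (x : nat -> nat) : (forall i, x i < k) ->
  exists2 c, c < k ^ N & forall i, i < N -> digit k c i = x i.
Proof.
elim: N x => [|N IHN] x x_k; first by exists 0.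
have k_gt0 : 0 < k by apply: leq_ltn_trans (x_k 0).
have [c c_lt c_x] := IHN (fun i => x i.+1) (fun i => x_k i.+1).
exists (c * k + x 0).
  rewrite expnSr; apply: (@leq_trans (c * k + k)); first by rewrite ltn_add2l.
  by rewrite addnC -mulSn leq_mul2r c_lt orbT.
case=> [|i] lt_iN; first by rewrite /digit expn0 divn1 modnMDl modn_small.
rewrite /digit expnS divnMA divnMDl // (divn_small (x_k 0)) addn0.
exact: c_x.
Qed.

(** Koenig's lemma: among the finite words that are prefixes of infinitely many
    of the [f N], every one has a one-letter extension of the same kind, and an
    infinite branch of such prefixes is a cluster point. *)
Lemma konig k (f : nat -> nat -> nat) : (forall n i, f n i < k) ->
  exists x, forall M N0, exists2 N, N0 <= N & forall i, i < M -> f N i = x i.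
Proof.
move=> f_k.
pose P s := forall N0, exists2 N, N0 <= N &
  forall i, i < size s -> f N i = nth 0 s i.
have P_rcons s : exists a, P s -> P (rcons s a).
  apply/not_existsP => noext.
  have noext_from a : exists N0, forall N, N0 <= N ->
      (forall i, i < size s -> f N i = nth 0 s i) -> f N (size s) <> a.
    apply: contrapT => /forallNP noN; apply: (noext a) => _ N0.
    have /existsNP[N /not_implyP[le_N0 /not_implyP[fs /contrapT fa]]] := noN N0.
    exists N => // i; rewrite size_rcons ltnS leq_eqVlt nth_rcons.
    by case/predU1P=> [->|lti]; rewrite ?ltnn ?eqxx // lti fs.
  have Ps : P s by apply: contrapT => nPs; apply: (noext 0).
  have [N0 N0P] := choice noext_from.
  have [N le_N fs] := Ps (\max_(a < k) N0 a).
  apply: (N0P (f N (size s)) N _ fs) => //; apply: leq_trans le_N.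
  exact: (leq_bigmax (Ordinal (f_k N (size s)))).
have [next nextP] := choice P_rcons.
pose s n := iter n (fun s => rcons s (next s)) [::].
have size_s n : size (s n) = n by elim: n => //= n IHn; rewrite size_rcons IHn.
have Ps n : P (s n).
  by elim: n => [|n IHn]; [move=> N0; exists N0 | apply: nextP].
have nth_s n i : i < n -> nth 0 (s n) i = next (s i).
  elim: n => // n IHn; rewrite ltnS /= nth_rcons size_s leq_eqVlt.
  by case/predU1P=> [->|lti]; rewrite ?ltnn ?eqxx // lti IHn.
exists (fun i => next (s i)) => M N0.
have [N leN fN] := Ps M N0; exists N => // i ltiM.
by rewrite fN ?size_s // nth_s.
Qed.

(** A family of constraints on colourings of nat, where the j-th one only looks
    at positions up to [bound j]. *)
Section Compactness.
Variables (k : nat) (clause : nat -> (nat -> nat) -> bool) (bound : nat -> nat).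
Hypothesis clause_local : forall j x y,
  (forall i, i <= bound j -> x i = y i) -> clause j x = clause j y.

(** Only the constraints whose positions all lie below N are tested: digits at
    further positions carry no information. *)
Definition refuted N :=
  all (fun c =>
    has (fun j => (bound j < N) && ~~ clause j (digit k c)) (iota 0 N))
  (iota 0 (k ^ N)).

(** Compactness makes unsatisfiability semi-decidable: if the constraints have
    no solution, then some finite stage already excludes all finite colourings. *)
Lemma satisfiableP : 0 < k ->
  (exists x, (forall i, x i < k) /\ forall j, clause j x) <->
  forall N, ~~ refuted N.
Proof.
move=> k_gt0; split=> [[x [x_k x_sat]] N|unref].
  have [c c_lt c_x] := digits_surj N x_k.
  rewrite -has_predC; apply/hasP; exists c; first by rewrite mem_iota.
  apply/hasPn => j _; rewrite negb_and negbK orbC.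
  case: ltnP => [lt_jN|]; rewrite ?orbT // orbF.
  rewrite (clause_local (y := x)) // => i le_i.
  by apply: c_x; apply: leq_ltn_trans lt_jN.
have {unref} /choice[c cP] N : exists c, forall j, j < N -> bound j < N ->
    clause j (digit k c).
  have := unref N; rewrite -has_predC => /hasP[c _ /hasPn cP].
  exists c => j lt_jN lt_bN; have := cP j.
  by rewrite mem_iota lt_bN /= negbK; apply.
have f_k N i : digit k (c N) i < k by rewrite ltn_mod.
have [x xP] := konig f_k; exists x; split=> [i|j].
  by have [N _ <-] := xP i.+1 0.
have [N] := xP (bound j).+1 (maxn j (bound j)).+1.
rewrite gtn_max => /andP[lt_jN lt_bN] fx.
by rewrite -(clause_local (x := digit k (c N))) ?cP // => i /fx.
Qed.
End Compactness.

(** * Words as numbers *)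

Definition letter (l : nat * bool) : nat := (nat_of_bool l.2 + l.1.*2)%N.

Definition gword_of_code c : gword := [seq (l./2, odd l) | l <- decode c].

Lemma gword_codeK : cancel gword_code gword_of_code.
Proof.
move=> w; rewrite /gword_of_code CodeSeq.codeK -map_comp -[RHS]map_id.
apply: eq_map => -[a b] /=.
by rewrite half_bit_double oddD odd_double addbF oddb.
Qed.

Lemma gword_of_codeK : cancel gword_of_code gword_code.
Proof.
move=> c; rewrite /gword_code /gword_of_code -map_comp -[RHS]CodeSeq.decodeK.
congr code; rewrite -[RHS]map_id; apply: eq_map => l /=.
by rewrite odd_double_half.
Qed.

Lemma cat_gword_code u v :
  cat_code (gword_code u) (gword_code v) = gword_code (u ++ v).
Proof. by rewrite /cat_code !CodeSeq.codeK -map_cat. Qed.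

(** * Rewriting words by relators *)

Section Moves.
Variable relator : nat -> nat.

(** A number t codes a place (a prefix and a suffix) together with the index of
    a relator; the associated move inserts the relator there, or deletes it. *)
Definition relator_in t :=
  cat_code (nth 0 (decode t) 0)
    (cat_code (relator (nth 0 (decode t) 1)) (nth 0 (decode t) 2)).
Definition relator_out t := cat_code (nth 0 (decode t) 0) (nth 0 (decode t) 2).

(** A total function, the identity where it does not apply, and an involution
    in c: a derivation is then any list of numbers, and derivability is
    symmetric. *)
Definition move c t :=
  if c == relator_in t then relator_out t
  else if c == relator_out t then relator_in t else c.

Definition connected c d := exists ts, foldl move c ts = d.

Lemma moveK t : involutive (move^~ t).
Proof.
move=> c; rewrite /move; case: (eqVneq c (relator_in t)) => [->|neq_in].
  by rewrite eqxx; case: eqP.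
case: (eqVneq c (relator_out t)) => [->|neq_out]; first by rewrite eqxx.
by rewrite (negPf neq_in) (negPf neq_out).
Qed.

Lemma connected_refl c : connected c c.
Proof. by exists [::]. Qed.

Lemma connected_trans c d e : connected c d -> connected d e -> connected c e.
Proof. by move=> [s <-] [t <-]; exists (s ++ t); rewrite foldl_cat. Qed.

Lemma connected_sym c d : connected c d -> connected d c.
Proof.
case=> ts <-; elim: ts c => [|t ts IHts] c; first exact: connected_refl.
by apply: connected_trans (IHts _) _; exists [:: t]; apply: moveK.
Qed.

Lemma connected_relator k p q :
  connected (cat_code p (cat_code (relator k) q)) (cat_code p q).
Proof.
have [t tK] : exists t, decode t = [:: p; k; q].
  by exists (code [:: p; k; q]); rewrite CodeSeq.codeK.
by exists [:: t]; rewrite /= /move /relator_in /relator_out tK /= eqxx.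
Qed.

Lemma recursive_relator_in n f :
  recursive 1 (fun v => relator (nth 0 v 0)) -> recursive n f ->
  recursive n (fun v => relator_in (f v)).
Proof.
move=> rrel rf; apply: recursive_cat; first by auto with recursive.
by apply: recursive_cat; [apply: recursive_lift1 rrel _ |]; auto with recursive.
Qed.

Lemma recursive_relator_out n f :
  recursive n f -> recursive n (fun v => relator_out (f v)).
Proof. by rewrite /relator_out; auto with recursive. Qed.

Lemma recursive_move : recursive 1 (fun v => relator (nth 0 v 0)) ->
  recursive 2 (fun v => move (nth 0 v 0) (nth 0 v 1)).
Proof.
move=> rrel; have := fun n f => @recursive_relator_in n f rrel.
have := recursive_relator_out; rewrite /move; auto 20 with recursive.
Qed.
End Moves.

(** * Colourings of the set of words *)

Lemma leq_sumn (T : eqType) (f : T -> nat) s x :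
  x \in s -> f x <= sumn [seq f y | y <- s].
Proof.
elim: s => //= y s IHs; rewrite inE => /predU1P[->|/IHs]; first exact: leq_addr.
by move/leq_trans; apply; apply: leq_addl.
Qed.

(** Colour the words of a presentation of G by the colours of a subshift X. The
    clauses say, in turn, that the colouring is constant on the words equal
    modulo the relators, that it is invariant under left multiplication by u, and
    that no forbidden pattern appears. A pattern is a list of pairs (word,
    colour). *)
Section Tiling.
Variables (relator : nat -> nat) (patterns : seq (seq (nat * nat))) (u : nat).

Definition tiling_clause j (x : nat -> nat) :=
  [&& x (relator_in relator j) == x (relator_out j), x (cat_code u j) == x j
    & all (fun p => has (fun q => x (cat_code j q.1) != q.2) p) patterns].

Definition tiling_bound j :=
  relator_in relator j + relator_out j + cat_code u j + j
  + sumn [seq sumn [seq cat_code j q.1 | q <- p] | p <- patterns].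

Lemma tiling_clause_local j x y :
  (forall i, i <= tiling_bound j -> x i = y i) ->
  tiling_clause j x = tiling_clause j y.
Proof.
move=> xy; have le_patterns p q : p \in patterns -> q \in p ->
    cat_code j q.1 <= tiling_bound j.
  move=> p_in q_in; rewrite /tiling_bound; apply: leq_trans (leq_addl _ _).
  apply: leq_trans (leq_sumn (fun p => sumn _) p_in).
  exact: (leq_sumn (fun q => cat_code j q.1)).
rewrite /tiling_clause !xy; try by rewrite /tiling_bound; lia.
congr [&& _, _ & _]; apply: eq_in_all => p p_in; apply: eq_in_has => q q_in.
by rewrite xy // (le_patterns p).
Qed.
End Tiling.

Lemma recursive_refuted k relator patterns n f N :
  recursive 1 (fun v => relator (nth 0 v 0)) ->
  recursive n f -> recursive n N ->
  recursive n (fun v => refuted k (tiling_clause relator patterns (f v))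
                          (tiling_bound relator patterns (f v)) (N v)).
Proof.
move=> rrel; have := fun n f => @recursive_relator_in relator n f rrel.
have := recursive_relator_out => rout rin.
apply: (@recursive_lift2 _ (fun u N => refuted k
  (tiling_clause relator patterns u) (tiling_bound relator patterns u) N)).
rewrite /refuted /tiling_clause /tiling_bound.
apply: recursive_all; first by auto with recursive.
apply: recursive_has; first by auto with recursive.
auto 20 with recursive.
Qed.

(** * Stabilisers and the semantics of the two searches *)

Lemma geval_cat (G : groupType) (phi : nat -> G) u v :
  geval phi (u ++ v) = (geval phi u * geval phi v)%g.
Proof. exact: big_cat. Qed.

Lemma geval_cancel (G : groupType) (phi : nat -> G) a b :
  geval phi [:: (a, b); (a, ~~ b)] = 1%g.
Proof.
by rewrite /geval big_cons big_seq1; case: b; rewrite /= ?mulVg ?mulgV.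
Qed.

Section Shift.
Variables (G : groupType) (A : finType).
Implicit Types (x : G -> A) (X : set (G -> A)).

Lemma shiftM g h x : shift (g * h)%g x = shift g (shift h x).
Proof. by apply: funext => t; rewrite /shift invgM mulgA. Qed.

Lemma SFT_shift X x g : is_SFT X -> X x -> X (shift g x).
Proof.
case=> F -> /= Xx p Fp [h hP]; apply: (Xx p Fp).
by exists (g^-1 * h)%g => k; rewrite hP /shift mulgA.
Qed.

(** The stabiliser of a translate is a conjugate of the stabiliser. When all
    stabilisers agree, they are therefore normal. *)
Lemma stab_normal X (H : set G) : is_SFT X -> X !=set0 ->
  (forall x, X x -> stab x = H) -> forall g h, H h -> H (g * h * g^-1)%g.
Proof.
move=> sftX [x Xx] stabX g h Hh.
rewrite -(stabX _ (SFT_shift g sftX Xx)) /stab /=.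
rewrite -shiftM mulgVK shiftM; congr shift.
by move: Hh; rewrite -(stabX _ Xx).
Qed.
End Shift.

(** The relators all represent elements of H; among them are those of the
    presentation of G, words for generators of H and the trivial cancellations,
    so that the moves present G / H. *)
Section Membership.
Variables (G : groupType) (H : set G) (phi : nat -> G).
Variables (S0 : set nat) (R : set gword) (hs : seq gword).
Variable relator : nat -> nat.
Hypothesis subH : subgroup H.
Hypothesis normH : forall g h, H h -> H (g * h * g^-1)%g.
Hypothesis presG : presents S0 R phi.
Hypothesis hs_over : forall w, w \in hs -> word_over S0 w.
Hypothesis genH : H = generated [set geval phi w | w in [set` hs]].
Hypothesis relator_sound : forall k, H (geval phi (gword_of_code (relator k))).
Hypothesis relator_cancel :
  forall a b, exists k, relator k = gword_code [:: (a, b); (a, ~~ b)].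
Hypothesis relator_pres : forall w, R w -> exists k, relator k = gword_code w.
Hypothesis relator_gen :
  forall w, w \in hs -> exists k, relator k = gword_code w.

Let ev c := geval phi (gword_of_code c).

Lemma ev_cat c d : ev (cat_code c d) = (ev c * ev d)%g.
Proof.
rewrite -(gword_of_codeK c) -(gword_of_codeK d) cat_gword_code.
by rewrite /ev !gword_codeK geval_cat.
Qed.

(** Normality of H is what allows a relator to be inserted in the middle of a
    word without changing the coset. *)
Lemma ev_relator_in t :
  exists2 h, H h & ev (relator_in relator t) = (h * ev (relator_out t))%g.
Proof.
rewrite /relator_in /relator_out !ev_cat.
set p := ev (nth _ _ _); set q := ev (nth _ _ 2); set z := ev (relator _).
exists (p * z * p^-1)%g; first by apply: normH; apply: relator_sound.
by rewrite -!mulgA mulKg.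
Qed.

Lemma subgroup_mull h g : H h -> H (h * g)%g <-> H g.
Proof.
case: subH => _ HM HV Hh; split=> [Hhg|]; last exact: HM.
by rewrite -(mulKg h g); apply: HM => //; apply: HV.
Qed.

Lemma ev_move c t : H (ev (move relator c t)) <-> H (ev c).
Proof.
have [h Hh ev_in] := ev_relator_in t.
rewrite /move; case: eqP => [->|_]; first by rewrite ev_in subgroup_mull.
by case: eqP => [->|_] //; rewrite ev_in subgroup_mull.
Qed.

Lemma ev_connected c d : connected relator c d -> H (ev c) <-> H (ev d).
Proof.
case=> ts <-; elim: ts c => //= t ts IHts c.
exact: iff_trans (iff_sym (ev_move c t)) (IHts _).
Qed.

Lemma connected_insert k w u v : relator k = gword_code w ->
  connected relator (gword_code (u ++ w ++ v)) (gword_code (u ++ v)).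
Proof. by move=> zk; rewrite -!cat_gword_code -zk; apply: connected_relator. Qed.

Lemma pres_connected u v : pres_eq S0 R u v ->
  connected relator (gword_code u) (gword_code v).
Proof.
elim=> {u v} [u|u v _|u v w _ cuv _|u v a b _|u v r Rr].
- exact: connected_refl.
- exact: connected_sym.
- exact: connected_trans cuv.
- by have [k zk] := relator_cancel a b; apply: (connected_insert _ _ zk).
by have [k zk] := relator_pres Rr; apply: connected_insert zk.
Qed.

(** The elements g such that connectedness absorbs right multiplication by g
    form a subgroup, because connectedness is an equivalence relation; it contains
    the generators of H since their words are relators. *)
Lemma coset_connected u v : word_over S0 u -> word_over S0 v ->
  H ((geval phi u)^-1 * geval phi v)%g ->
  connected relator (gword_code u) (gword_code v).
Proof.
have [gen pres] := presG.
pose K := [set g | forall u v, word_over S0 u -> word_over S0 v ->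
  (geval phi u)^-1 * geval phi v = g ->
  connected relator (gword_code u) (gword_code v)]%g.
suff: H `<=` K by move=> HK Su Sv /HK; apply.
rewrite genH; apply: smallest_sub.
  split=> [s t Ss St|g h Kg Kh s t Ss St|g Kg s t Ss St].
  - move=> e; apply: pres_connected; apply/pres => //.
    by rewrite -[RHS](mulVKg (geval phi s)) e mulg1.
  - move=> e; have [w Sw ew] := gen (geval phi s * g)%g.
    apply: (@connected_trans _ _ (gword_code w)).
      by apply: Kg => //; rewrite ew mulKg.
    by apply: Kh => //; rewrite ew invgM -mulgA e mulKg.
  move=> e; apply: connected_sym; apply: Kg => //.
  by rewrite -[g]invgK -e invgM invgK.
move=> _ /= [w w_hs <-] s t Ss St e.
have Ssw : word_over S0 (s ++ w).
  by move=> l; rewrite mem_cat => /orP[/Ss|/(hs_over w_hs)].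
have [k zk] := relator_gen w_hs.
apply: (@connected_trans _ _ (gword_code (s ++ w))).
  by apply: connected_sym; have := connected_insert s [::] zk; rewrite !cats0.
apply: pres_connected; apply/pres => //.
by rewrite geval_cat -e mulVKg.
Qed.

(** Membership in H is derivability from the empty word, hence semi-decidable. *)
Lemma membership_connected u : word_over S0 u ->
  H (geval phi u) <-> connected relator 0 (gword_code u).
Proof.
move=> Su; split=> [Hu|c0u].
  apply: (@coset_connected [::]) => //.
  by rewrite /geval big_nil invg1 mul1g.
rewrite -[u]gword_codeK; apply/(ev_connected c0u).
by rewrite /ev /geval big_nil; case: subH.
Qed.

Section Tilings.
Variables (A : finType) (F : {fset {fmap G -> A}}).
Let X := [set x | forall p, p \in F -> ~ @appears G A p x].
Hypothesis X_neq0 : X !=set0.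
Hypothesis stabX : forall x, X x -> stab x = H.
Variable rep : G -> gword.
Hypothesis rep_over : forall g, word_over S0 (rep g).
Hypothesis repK : forall g, geval phi (rep g) = g.

Definition coded_pattern (p : {fmap G -> A}) : seq (nat * nat) :=
  [seq (gword_code (rep (val h)), nat_of_ord (enum_rank (p h)))
  | h <- enum {: domf p}].

Definition coded_patterns := [seq coded_pattern p | p <- enum_fset F].

(** Non-membership in H is unsatisfiability. If u lies in H, any x in X is
    invariant under H and induces a colouring of words. Conversely a colouring
    descends to a configuration of X that u fixes, and u then lies in its
    stabiliser, which is H. *)
Lemma tilingP u : word_over S0 u -> H (geval phi u) <->
  exists x, (forall i, x i < #|A|) /\
    forall j, tiling_clause relator coded_patterns (gword_code u) j x.
Proof.
move=> Su; split=> [Hu|[x [x_A x_sat]]].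
  have [x Xx] := X_neq0.
  have xH h g : H h -> x (h * g)%g = x g.
    move=> Hh; have : stab x (h^-1)%g.
      by rewrite (stabX Xx); case: subH => _ _; apply.
    by move/(congr1 (fun y => y g)); rewrite /shift invgK.
  exists (fun c => nat_of_ord (enum_rank (x (ev c)))); split=> // j.
  apply/and3P; split.
  - by have [h Hh ->] := ev_relator_in j; rewrite xH.
  - by rewrite ev_cat xH // /ev gword_codeK.
  apply/allP=> _ /mapP[p Fp ->]; apply/negPn/negP => /hasPn no_q.
  apply: (Xx p Fp); exists (ev j) => h.
  have := no_q (gword_code (rep (val h)), nat_of_ord (enum_rank (p h))).
  rewrite negbK ev_cat /= /ev gword_codeK repK.
  have -> : (gword_code (rep (val h)), nat_of_ord (enum_rank (p h)))
      \in coded_pattern p by apply: map_f; rewrite mem_enum.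
  by move=> /(_ isT)/eqP/val_inj/enum_rank_inj.
have [a0 _] : exists a0 : A, True.
  by have [x' _] := X_neq0; exists (x' 1%g).
pose y g := nth a0 (enum A) (x (gword_code (rep g))).
(* By the first clause, y does not depend on the representatives chosen. *)
have yE w : word_over S0 w ->
    y (geval phi w) = nth a0 (enum A) (x (gword_code w)).
  move=> Sw; rewrite /y.
  suff: connected relator (gword_code (rep (geval phi w))) (gword_code w).
    case=> ts <-; elim: ts (gword_code _) => //= t ts IHts c.
    rewrite -IHts /move; have /and3P[/eqP e _ _] := x_sat t.
    by do 2 ?[case: eqP => [->|_]] => //; rewrite e.
  apply: coset_connected => //; rewrite repK mulVg.
  by case: subH.
have word_over_cat v w :
    word_over S0 v -> word_over S0 w -> word_over S0 (v ++ w).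
  by move=> Sv Sw l; rewrite mem_cat => /orP[/Sv|/Sw].
have Xy : X y.
  move=> p Fp [g gP].
  have /and3P[_ _ /allP x_avoid] := x_sat (gword_code (rep g)).
  have /hasP[_ /mapP[h _ ->] /eqP[]] := x_avoid _ (map_f coded_pattern Fp).
  rewrite /= cat_gword_code; move: (gP h).
  rewrite -{1}[g]repK -{1}[val h]repK -geval_cat yE; last exact: word_over_cat.
  set c := gword_code _ => ->.
  by have /= <- := enum_val_nth a0 (Ordinal (x_A c)); rewrite enum_valK.
case: subH => _ _ HV; rewrite -[geval _ _]invgK; apply: HV.
rewrite -(stabX Xy) /stab /=; apply: funext => g; rewrite /shift invgK.
rewrite -[g]repK -geval_cat yE; last exact: word_over_cat.
rewrite yE // -cat_gword_code.
by have /and3P[_ /eqP-> _] := x_sat (gword_code (rep g)).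
Qed.
End Tilings.
End Membership.

(** * Enumerating the relators and reading the input *)

Lemma re_set_enum (K : set nat) : re_set K ->
  exists r : nat -> nat, [/\ recursive 1 (fun v => r (nth 0 v 0)),
    forall c, K c -> exists k, r k = c & forall k, K (r k) \/ r k = 0].
Proof.
case=> [->|[f rf ->]].
  by exists (fun=> 0); split=> //; [exact: recursive_const | right].
exists (fun k => f [tuple k]); split=> [|c [k _ <-]|k].
- by apply: recursive_comp1 => //; apply: recursive_proj.
- by exists k.
by left; exists k.
Qed.

(** The inverse of the coded letter i: the lowest bit of a letter is its sign. *)
Definition inverse_letter i := if i %% 2 == 1 then i.-1 else i.+1.

Lemma inverse_letterE a b : inverse_letter (letter (a, b)) = letter (a, ~~ b).
Proof.
rewrite /inverse_letter /letter modn2 oddD odd_double addbF oddb /=.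
by case: b.
Qed.

(** The index of a relator is the code of a pair: a kind (relators of the
    presentation, cancellations, generators of H) and a number within the kind. *)
Lemma relator_enum (G : groupType) (H : set G) (phi : nat -> G)
    (R : set gword) (hs : seq gword) :
  H 1%g -> re_set (gword_code @` R) -> (forall w, R w -> geval phi w = 1%g) ->
  (forall w, w \in hs -> H (geval phi w)) ->
  exists relator, [/\ recursive 1 (fun v => relator (nth 0 v 0)),
    forall k, H (geval phi (gword_of_code (relator k))),
    forall a b, exists k, relator k = gword_code [:: (a, b); (a, ~~ b)],
    forall w, R w -> exists k, relator k = gword_code w &
    forall w, w \in hs -> exists k, relator k = gword_code w].
Proof.
move=> H1 reR trivR hsH; have [r [rec_r r_onto r_in]] := re_set_enum reR.
pose hcode := code [seq gword_code w | w <- hs].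
(* In the second case the value is the code of the pair of letters
   [:: i; inverse_letter i]; in the third, indices out of range give the empty
   word, which is harmless. *)
pose relator k := let i := nth 0 (decode k) 1 in
  if nth 0 (decode k) 0 == 0 then r i
  else if nth 0 (decode k) 0 == 1 then 2 ^ i * (2 ^ inverse_letter i * 2).+1
  else nth 0 (decode hcode) i.
have relatorE kind i : exists k, relator k =
    if kind == 0 then r i else if kind == 1
    then code [:: i; inverse_letter i] else nth 0 (decode hcode) i.
  exists (code [:: kind; i]); rewrite /relator CodeSeq.codeK /=.
  by case: ifP => // _; case: ifP => // _; rewrite -muln2 muln1.
exists relator; split.
- rewrite /relator; apply: recursive_if; first by auto with recursive.
    by apply: (recursive_lift1 rec_r); auto with recursive.
  by rewrite /inverse_letter; auto 20 with recursive.
- have H0 : H (geval phi (gword_of_code 0)) by rewrite /geval big_nil.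
  move=> k; rewrite /relator; set i := nth 0 _ 1; case: ifP => _.
    case: (r_in i) => [[w Rw <-]|->] //.
    by rewrite gword_codeK trivR.
  case: ifP => _.
    have -> : 2 ^ i * (2 ^ inverse_letter i * 2).+1 =
        gword_code [:: (i./2, odd i); (i./2, ~~ odd i)].
      rewrite /gword_code /= -/(letter (i./2, ~~ odd i)) -inverse_letterE.
      rewrite /letter /= odd_double_half; lia.
    by rewrite gword_codeK geval_cancel.
  rewrite CodeSeq.codeK; have [lt_i|le_i] := ltnP i (size hs).
    by rewrite (nth_map [::]) // gword_codeK; apply/hsH/mem_nth.
  by rewrite nth_default ?size_map.
- move=> a b; have [k kE] := relatorE 1 (letter (a, b)); exists k.
  by rewrite kE /= inverse_letterE.
- move=> w Rw; have [|i rE] := r_onto (gword_code w); first by exists w.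
  by have [k kE] := relatorE 0 i; exists k; rewrite kE.
move=> w w_hs; have [k kE] := relatorE 2 (index w hs); exists k.
by rewrite kE /= CodeSeq.codeK (nth_map [::]) ?index_mem // nth_index.
Qed.

(** Substitution of a word for each letter, through a finite table. Letters
    outside the table become the empty word, so that every number, even one that
    codes no legitimate input, is translated to a word over the alphabet of the
    presentation, and the search of the algorithm terminates on it. *)
Definition translate table c :=
  foldl (fun acc s => cat_code acc (nth 0 (decode (code table)) s)) 0
    (decode c).

Lemma recursive_translate table n f :
  recursive n f -> recursive n (fun v => translate table (f v)).
Proof. by move=> rf; apply: recursive_foldl; auto with recursive. Qed.

Lemma translateE (ws : seq gword) s :
  translate [seq gword_code w | w <- ws] (code s)
  = gword_code (flatten [seq nth [::] ws i | i <- s]).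
Proof.
rewrite /translate !CodeSeq.codeK.
suff foldlE w : foldl
    (fun acc i => cat_code acc (nth 0 [seq gword_code w | w <- ws] i))
    (gword_code w) s = gword_code (w ++ flatten [seq nth [::] ws i | i <- s]).
  exact: (foldlE [::]).
elim: s w => [|i s IHs] w /=; first by rewrite cats0.
rewrite catA -IHs -cat_gword_code; congr (foldl _ (cat_code _ _) s).
have [lt_i|le_i] := ltnP i (size ws); first by rewrite (nth_map [::]).
by rewrite !nth_default ?size_map.
Qed.

Theorem theorem2 (G : groupType) (H : set G)
  (G_fg : finitely_generated [set: G])
  (G_rp : recursively_presented G)
  (H_subgroup : subgroup H)
  (H_fg : finitely_generated H)
  (H_real : realizable H)
  (S : {fset G}) (S_gen : symmetric_generating S) :
  membership_decidable S H.
Proof.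
have [A [X [_ X_neq0 sftX stabX_H]]] := H_real.
have stabX x : X x -> stab x = H.
  by move=> Xx; have : [set H] (stab x) by rewrite -stabX_H; exists x.
have normH := stab_normal sftX X_neq0 stabX.
have [F XE] := sftX.
have [S0 [R [phi [_ reR R_over presG]]]] := G_rp.
have [gen pres] := presG.
have /choice[rep repP] g : exists w, word_over S0 w /\ geval phi w = g.
  by have [w Sw ew] := gen g; exists w.
have rep_over g : word_over S0 (rep g) by case: (repP g).
have repK g : geval phi (rep g) = g by case: (repP g).
have [B HE] := H_fg.
pose hs := [seq rep h | h <- enum_fset B].
have BH h : h \in B -> H h.
  by move=> Bh; rewrite HE; apply: sub_gen_smallest.
have hs_over w : w \in hs -> word_over S0 w by case/mapP=> h _ ->.
have genH : H = generated [set geval phi w | w in [set` hs]].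
  rewrite HE; congr generated; apply/seteqP.
  split=> [h Bh|_ [w /mapP[h Bh ->] <-]].
    by exists (rep h); [apply: map_f | apply: repK].
  by rewrite repK.
have [H1 _ _] := H_subgroup.
have trivR w : R w -> geval phi w = 1%g.
  move=> Rw; have -> : 1%g = geval phi [::] by rewrite /geval big_nil.
  apply/pres => //; first exact: R_over.
  by have := PresRel S0 [::] [::] Rw; rewrite cats0.
have hsH w : w \in hs -> H (geval phi w).
  by case/mapP=> h Bh ->; rewrite repK; apply: BH.
have [relator [rec_rel rel_sound rel_cancel rel_pres rel_gen]] :=
  relator_enum H1 reR trivR hsH.
pose pats := coded_patterns F rep.
pose table := [seq rep (val s) | s <- enum {: S}].
(* The algorithm reads only u, the first of the words in its input. *)
pose input v := translate [seq gword_code w | w <- table]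
  (nth 0 (decode (nth 0 v 0)) 0).
pose derives k v := foldl (move relator) 0 (decode k) == input v.
pose refutes k v := refuted #|A| (tiling_clause relator pats (input v))
  (tiling_bound relator pats (input v)) k.
have input_word v : exists2 w, word_over S0 w & input v = gword_code w.
  rewrite /input -[nth _ _ _]CodeSeq.decodeK translateE.
  eexists; last by [].
  move=> l /flattenP[w /mapP[i _ ->]].
  have [lt_i|le_i] := ltnP i (size table); last by rewrite nth_default.
  have /mapP[s _ ->] := mem_nth [::] lt_i.
  by apply: rep_over.
have derivesP v w : word_over S0 w -> input v = gword_code w ->
    H (geval phi w) <-> exists k, derives k v.
  move=> Sw vw; have mem := membership_connected H_subgroup normH presG
    hs_over genH rel_sound rel_cancel rel_pres rel_gen Sw.
  apply: (iff_trans mem); rewrite /derives vw; split=> [[ts e]|[k /eqP e]].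
    by exists (code ts); rewrite CodeSeq.codeK e.
  by exists (decode k).
have A_gt0 : 0 < #|A|.
  by have [x _] := X_neq0; apply/card_gt0P; exists (x 1%g).
have refutesP v w : word_over S0 w -> input v = gword_code w ->
    H (geval phi w) <-> forall k, ~~ refutes k v.
  move=> Sw vw; rewrite XE in X_neq0 stabX.
  have til := tilingP H_subgroup normH presG hs_over genH rel_sound
     rel_cancel rel_pres rel_gen X_neq0 stabX rep_over repK Sw.
  apply: (iff_trans til); rewrite /refutes vw.
  by apply: satisfiableP => //; apply: tiling_clause_local.
have rinput : recursive 2 (fun v => input (behead v)).
  by apply: recursive_translate; auto with recursive.
have [|||v k l|b rec_b bP] := @recursive_complement 1 derives refutes.
- apply: recursive_eq rinput; apply: recursive_foldl; auto with recursive.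
  exact: recursive_move.
- by apply: recursive_refuted; auto with recursive.
- move=> v; have [w Sw vw] := input_word v.
  have [Hw|nHw] := pselect (H (geval phi w)).
    by have [k der_k] := (derivesP v w Sw vw).1 Hw; exists k; rewrite der_k.
  have /existsNP[k /negP] := contra_not (refutesP v w Sw vw).2 nHw.
  by rewrite negbK => ref_k; exists k; rewrite ref_k orbT.
- have [w Sw vw] := input_word v; move=> der_k.
  by apply: (refutesP v w Sw vw).1; apply/(derivesP v w Sw vw); exists k.
exists (fun v => b v) => // u ws _.
pose v := [:: code [seq word_code w | w <- u :: ws]].
rewrite -[LHS]/(nat_of_bool (b v)).
have vu : input v = gword_code (flatten [seq rep (val s) | s <- u]).
  have v_word : nth 0 (decode (nth 0 v 0)) 0 = word_code u.
    exact: (congr1 (nth 0 ^~ 0) (CodeSeq.codeK _)).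
  rewrite /input v_word /word_code translateE -map_comp.
  congr (gword_code (flatten _)).
  apply: eq_map => s /=; rewrite (nth_map s) ?nth_enum_rank //.
  by rewrite -cardE ltn_ord.
have Su : word_over S0 (flatten [seq rep (val s) | s <- u]).
  by move=> l /flattenP[_ /mapP[s _ ->]]; apply: rep_over.
have eu : geval phi (flatten [seq rep (val s) | s <- u]) = weval u.
  rewrite /weval; elim: (u) => [|s u' IHu] /=; first by rewrite /geval !big_nil.
  by rewrite geval_cat big_cons repK IHu.
congr nat_of_bool; apply/idP/asboolP => [bv|Hu].
  by rewrite -eu; apply/(derivesP v _ Su vu)/bP.
by apply/bP/(derivesP v _ Su vu); rewrite eu.
Qed.
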